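(* Let $E$ be an evolution algebra with natural basis $\{e_1,\dots,e_{2n}\}$ whose matrix in this basis has non-negative integer entries. Let $Z_1=\{1,\dots,n\}$, $Z_2=\{n+1,\dots,2n\}$. Then $E$ is a complete bipartite evolution algebra with partitions of equal size (the parts being $Z_1$ and $Z_2$) if and only if for some even $k$ with $2\le k\le 2n$ the following holds for all $i_1,\dots,i_k\in\{1,\dots,2n\}$: $$(\dots((e_{i_1}e_{i_1})e_{i_2})\dots)e_{i_k}=\begin{cases}0,&\text{if there exists } p \text{ such that } \{i_p,i_{p+1}\}\subseteq Z_1 \text{ or } \{i_p,i_{p+1}\}\subseteq Z_2,\\ \displaystyle\sum_{j\in Z(i_k)}e_j,&\text{otherwise},\end{cases}$$ where $1\le p\le k-1$ and $Z(i_k)$ denotes the one of the two sets $Z_1,Z_2$ that does not contain $i_k$.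
   Context: An evolution algebra over a field $K$ is a vector space $E$ over $K$ with a bilinear multiplication and a basis $\{e_1,e_2,\dots\}$ (called a natural basis) such that $e_ie_j=0$ for $i\neq j$ and $e_ie_i=\sum_k a_{ik}e_k$; here $K=\mathbb{C}$. The matrix $(a_{ij})$ is called the matrix of $E$ in the natural basis. The evolution algebra determined by a graph with adjacency matrix $(a_{ij})$ is the evolution algebra with $e_ie_i=\sum_k a_{ik}e_k$ in the natural basis indexed by the vertices. A complete bipartite evolution algebra is an evolution algebra determined by a complete bipartite graph; here this means that the matrix of $E$ in the given natural basis is the adjacency matrix of $K_{n,n}$ with parts $Z_1$ and $Z_2$. The left-hand side of the displayed identity is the left-normed product of $e_{i_1},e_{i_1},e_{i_2},\dots,e_{i_k}$. *)

(* Defs.v *)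
From HB Require Import structures.
From mathcomp Require Import all_boot all_order all_algebra.
From mathcomp Require Import reals complex.

Set Implicit Arguments.
Unset Strict Implicit.
Unset Printing Implicit Defensive.

Import GRing.Theory.
Local Open Scope ring_scope.

Section EvolutionAlgebra.
Variables (K : fieldType) (E : vectType K) (mul : {bilinear E -> E -> E}).
Variables (m : nat) (e : m.-tuple E).

(* (E, mul) is an evolution algebra exactly when it has a natural basis.
   The condition that each e_i e_i is a combination of the e_k needs no
   separate clause, since e is a basis of E. *)
Definition natural_basis : Prop :=
  basis_of fullv e /\
  (forall i j : 'I_m, i != j -> mul (tnth e i) (tnth e j) = 0).

(* Row i holds the coordinates of e_i e_i. *)
Definition evolution_mx : 'M[K]_m :=
  \matrix_(i, k) coord e k (mul (tnth e i) (tnth e i)).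

End EvolutionAlgebra.

Definition adjacency_mx (K : fieldType) (m : nat) (g : rel 'I_m) : 'M[K]_m :=
  \matrix_(i, j) (g i j)%:R.

Definition complete_bipartite (T : finType) (A B : {set T}) : rel T :=
  fun x y => (x \in A) && (y \in B) || (x \in B) && (y \in A).

Definition evolution_algebra_of_graph (K : fieldType) (E : vectType K)
    (mul : {bilinear E -> E -> E}) (m : nat) (e : m.-tuple E)
    (g : rel 'I_m) : Prop :=
  natural_basis mul e /\ evolution_mx mul e = adjacency_mx K g.

Definition complete_bipartite_evolution_algebra (K : fieldType)
    (E : vectType K) (mul : {bilinear E -> E -> E}) (m : nat)
    (e : m.-tuple E) (A B : {set 'I_m}) : Prop :=
  evolution_algebra_of_graph mul e (complete_bipartite A B).

(* (...((x s_1) s_2)...) s_r for s = [:: s_1; ...; s_r]; mul is not assumed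
   to be associative. *)
Definition left_normed (V : Type) (mul : V -> V -> V) (x : V) (s : seq V) : V :=
  foldl mul x s.

(* Indices are shifted by one: {1, ..., n} is {0, ..., n-1} in 'I_(2 * n). *)
Definition Z1 (n : nat) : {set 'I_(2 * n)} := [set i : 'I_(2 * n) | (i < n)%N].
Definition Z2 (n : nat) : {set 'I_(2 * n)} := [set i : 'I_(2 * n) | (n <= i)%N].

Definition Zopp (n : nat) (i : 'I_(2 * n)) : {set 'I_(2 * n)} :=
  if i \in Z1 n then Z2 n else Z1 n.

(* Main.v *)
Require Import Defs.
From HB Require Import structures.
From mathcomp Require Import all_boot all_order all_algebra.
From mathcomp Require Import reals complex.

Set Implicit Arguments.
Unset Strict Implicit.
Unset Printing Implicit Defensive.

Import GRing.Theory.
Local Open Scope ring_scope.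

(** In a natural basis, right multiplication by [e_j] kills every coordinate
    but the [j]-th: [x e_j = x_j (e_j e_j)].  Iterating, the left-normed product
    of [e_{i_1}, e_{i_1}, e_{i_2}, ..., e_{i_k}] is the weight
    [a_{i_1 i_2} a_{i_2 i_3} ... a_{i_{k-1} i_k}] of the walk [i_1, ..., i_k]
    times [e_{i_k} e_{i_k}] ([left_normed_walk]); its [j]-th coordinate is thus
    the weight of the walk times [a_{i_k j}].

    If the matrix is the adjacency matrix of the complete bipartite graph, the
    displayed identity can be read off from this already for [k = 2].

    Conversely, suppose that the identity holds for some [k].  Given a vertex
    [u], let the walk end at [u] and alternate between the two parts, and let
    [P] be its weight, a natural number.  The identity says that
    [P a_{uj} = 1] for [j] in the part opposite to [u], and [P a_{uj} = 0] for
    the other [j].  A product of natural numbers is [1] only if both factors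
    are, so [a_{uj} = 1] for [j] in the opposite part; as this part is nonempty,
    [P = 1] as well, so [a_{uj} = 0] for the other [j]. *)

Section NaturalBasis.
Variables (K : fieldType) (E : vectType K) (mul : {bilinear E -> E -> E}).
Variables (m : nat) (e : m.-tuple E).
Hypothesis e_nat : natural_basis mul e.

Lemma mul_natural_basis (x : E) (j : 'I_m) :
  mul x (tnth e j) = coord e j x *: mul (tnth e j) (tnth e j).
Proof.
have [e_basis e_orth] := e_nat.
rewrite {1}(coord_basis e_basis (memvf x)) linear_sumlz (bigD1 j) //=.
rewrite big1 ?addr0 => [|i neq_ij]; rewrite linearZl_LR -tnth_nth //.
by rewrite e_orth ?scaler0.
Qed.

Lemma sqr_natural_basis (u : 'I_m) :
  mul (tnth e u) (tnth e u) = \sum_j evolution_mx mul e u j *: tnth e j.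
Proof.
have [e_basis _] := e_nat.
rewrite {1}(coord_basis e_basis (memvf (mul _ _))).
by apply: eq_bigr => j _; rewrite mxE -tnth_nth.
Qed.

Lemma coord_sum_set (S : {set 'I_m}) (j : 'I_m) :
  coord e j (\sum_(l in S) tnth e l) = (j \in S)%:R.
Proof.
have [e_basis _] := e_nat.
rewrite -(coord_sum_free (fun l => (l \in S)%:R) j (basis_free e_basis)).
congr (coord e j _); rewrite big_mkcond; apply: eq_bigr => l _.
by rewrite -tnth_nth; case: ifP; rewrite ?scale1r ?scale0r.
Qed.

(** The walk has [k + 1] vertices [i 1, ..., i k.+1], hence [k] steps. *)
Lemma left_normed_walk (i : nat -> 'I_m) (k : nat) :
  left_normed mul (tnth e (i 1%N)) [seq tnth e (i p) | p <- iota 1 k.+1] =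
  (\prod_(1 <= p < k.+1) evolution_mx mul e (i p) (i p.+1)) *:
    mul (tnth e (i k.+1)) (tnth e (i k.+1)).
Proof.
elim: k => [|k IHk]; first by rewrite big_nil scale1r.
rewrite -[k.+2]addn1 iotaD map_cat cats1 /left_normed foldl_rcons.
rewrite -/(left_normed _ _ _) IHk add1n addn1 linearZl_LR.
rewrite (mul_natural_basis (mul _ _)) scalerA [in RHS]big_nat_recr //=.
by rewrite [evolution_mx mul e (i k.+1) _]mxE.
Qed.

End NaturalBasis.

Section Parts.
Variable n : nat.
Implicit Types u v : 'I_(2 * n).

Lemma mem_Zopp u v : (v \in Zopp u) = ((u < n) != (v < n))%N.
Proof. by rewrite /Zopp inE; case: (ltnP u n) => _; rewrite inE; case: ltnP. Qed.

Lemma complete_bipartite_Zopp u v :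
  complete_bipartite (Z1 n) (Z2 n) u v = (v \in Zopp u).
Proof. by rewrite /complete_bipartite mem_Zopp !inE; case: (ltnP u n); case: (ltnP v n). Qed.

Lemma same_part u v :
  ([set u; v] \subset Z1 n) || ([set u; v] \subset Z2 n) = (v \notin Zopp u).
Proof. by rewrite !subUset !sub1set mem_Zopp !inE; case: (ltnP u n); case: (ltnP v n). Qed.

Lemma Zopp_neq0 u : exists v, v \in Zopp u.
Proof.
have n_gt0 : (0 < n)%N by case: (n) u => [[]|].
have lt0 : (0 < 2 * n)%N by rewrite muln_gt0.
have ltn2 : (n < 2 * n)%N by rewrite mul2n -addnn -[X in (X < _)%N]addn0 ltn_add2l.
case: (ltnP u n) => lt_un; [exists (Ordinal ltn2) | exists (Ordinal lt0)].
  by rewrite mem_Zopp lt_un /= ltnn.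
by rewrite mem_Zopp ltnNge lt_un /= n_gt0.
Qed.

(** A walk alternating between the two parts can be prescribed to reach [u] at
    any given time [k]. *)
Lemma alternating_walk u k : exists2 i : nat -> 'I_(2 * n),
  i k = u & forall p, i p.+1 \in Zopp (i p).
Proof.
have [w w_opp] := Zopp_neq0 u.
exists (fun p => if odd p == odd k then u else w) => [|p]; first by rewrite eqxx.
rewrite /=; case: (odd p) (odd k) => [] [] //=.
all: by move: w_opp; rewrite !mem_Zopp 1?eq_sym.
Qed.

End Parts.

(* A family (i_1, ..., i_k) is given by i : nat -> 'I_(2 * n), of which only
   the values i 1, ..., i k are used. *)
Theorem corollary5p6 (R : realType) (n : nat) (n_gt0 : (0 < n)%N)
    (E : vectType R[i]) (mul : {bilinear E -> E -> E})
    (e : (2 * n).-tuple E) (e_nat : natural_basis mul e)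
    (mx_nat : forall i j, exists a : nat, evolution_mx mul e i j = a%:R) :
  complete_bipartite_evolution_algebra mul e (Z1 n) (Z2 n) <->
  exists k : nat,
    [/\ ~~ odd k, (2 <= k <= 2 * n)%N &
      forall i : nat -> 'I_(2 * n),
        left_normed mul (tnth e (i 1%N)) [seq tnth e (i p) | p <- iota 1 k] =
        if [exists p : 'I_k, (1 <= p)%N &&
              (([set i p; i p.+1] \subset Z1 n) ||
               ([set i p; i p.+1] \subset Z2 n))]
        then 0
        else \sum_(j in Zopp (i k)) tnth e j].
Proof.
split=> [[_ adj] | [k [_ /andP[k_ge2 _] walk_id]]].
  exists 2%N; split=> // [|i]; first by rewrite leq_pmulr.
  rewrite left_normed_walk // big_nat1 adj mxE complete_bipartite_Zopp.
  (* For k = 2 the only admissible p is 1. *)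
  have -> : [exists p : 'I_2, (1 <= p)%N &&
              (([set i p; i p.+1] \subset Z1 n) ||
               ([set i p; i p.+1] \subset Z2 n))] = (i 2 \notin Zopp (i 1%N)).
    apply/existsP/idP => [[[[|[|p]] //= _]]|opp]; first by rewrite same_part.
    by exists (lift ord0 ord0); rewrite same_part.
  case: (i 2 \in _); last by rewrite scale0r.
  rewrite scale1r sqr_natural_basis // [RHS]big_mkcond; apply: eq_bigr => j _.
  by rewrite adj mxE complete_bipartite_Zopp; case: ifP; rewrite ?scale1r ?scale0r.
split=> //; apply/matrixP=> u v; rewrite [RHS]mxE complete_bipartite_Zopp.
case: k k_ge2 walk_id => // k _ walk_id.
have [i i_k i_alt] := alternating_walk u k.+1.
have [P weightE] : exists P : nat,
    \prod_(1 <= p < k.+1) evolution_mx mul e (i p) (i p.+1) = P%:R.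
  apply: (big_ind (fun x => exists P : nat, x = P%:R)) => [|x y|p _].
  - by exists 1%N.
  - by move=> [a ->] [b ->]; exists (a * b)%N; rewrite natrM.
  - exact: mx_nat.
(* Compare the j-th coordinates of the two sides of the identity. *)
have coordE j : P%:R * evolution_mx mul e u j = (j \in Zopp u)%:R.
  rewrite -(coord_sum_set e_nat) -i_k -[Zopp _]/(Zopp (i k.+1)).
  move: (walk_id i); rewrite ifF; last first.
    by apply/existsP=> -[p /andP[_]]; rewrite same_part i_alt.
  by rewrite left_normed_walk // weightE => <-; rewrite linearZ /= mxE.
have coord_nat j a : evolution_mx mul e u j = a%:R -> (P * a)%N = (j \in Zopp u).
  by move=> aE; apply/eqP; rewrite -(Num.Theory.eqr_nat R[i]) natrM -aE coordE.
have [w w_opp] := Zopp_neq0 u.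
have [b bE] := mx_nat u w.
have [a aE] := mx_nat u v.
(* The vertex w opposite to u forces P = 1. *)
move: (coord_nat w b bE) (coord_nat v a aE); rewrite w_opp aE.
by move/eqP; rewrite muln_eq1 => /andP[/eqP-> _]; rewrite mul1n => ->.
Qed.
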